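(* Let $k$ be an algebraically closed field of characteristic zero and let $A$ be a finite-dimensional unital associative $k$-algebra. If $\Delta\in A$ is not a well-tempered element of $A$, then the augmented homotope $B=\widehat{A}_\Delta$ has infinite global dimension.
   Context: For a unital associative $k$-algebra $A$ and $\Delta\in A$, the homotope $A_\Delta$ is the vector space $A$ with the multiplication $a *_\Delta b = a\Delta b$. The augmented homotope $B=\widehat{A}_\Delta = k\cdot 1\oplus A_\Delta$ is obtained by externally adjoining a unit to $A_\Delta$; its augmentation ideal is $B^+=A_\Delta$, the kernel of the homomorphism $\epsilon:B\to k$ killing $A_\Delta$. The element $\Delta$ is called well-tempered if (1) $B^+$ is projective both as a left and as a right $B$-module, and (2) the multiplication map $B^+\otimes_k B^+\to B^+$, $a\otimes b\mapsto a\Delta b$, is surjective, i.e. $A\Delta A=A$. *)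

(* Defs.v *)
From HB Require Import structures.
From mathcomp Require Import all_boot all_order all_algebra all_field.

Set Implicit Arguments.
Unset Strict Implicit.
Unset Printing Implicit Defensive.

Import GRing.Theory.
Local Open Scope ring_scope.

(* Left R-modules are the members of lmodType R; right R-modules are the       *)
(* members of lmodType R^c, where R^c is the opposite ring.                    *)

Section HomologicalDimension.

Variable R : nzRingType.

Definition projective (P : lmodType R) : Prop :=
  forall (M N : lmodType R) (g : {linear M -> N}) (f : {linear P -> N}),
    (forall y : N, exists x : M, g x = y) ->
    exists h : {linear P -> M}, forall x : P, g (h x) = f x.

Record proj_resolution (M : lmodType R) := ProjResolution {
  res_mod : nat -> lmodType R;
  res_diff : forall i, {linear res_mod i.+1 -> res_mod i};
  res_aug : {linear res_mod 0%N -> M};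
  res_projective : forall i, projective (res_mod i);
  res_aug_surj : forall y : M, exists x, res_aug x = y;
  res_exact0 : forall x, res_aug x = 0 <-> exists y, res_diff 0 y = x;
  res_exactS : forall i x,
    res_diff i x = 0 <-> exists y, res_diff i.+1 y = x
}.

Definition pdim_le (M : lmodType R) (n : nat) : Prop :=
  exists r : proj_resolution M,
    forall i, (n < i)%N -> forall x : res_mod r i, x = 0.

Definition left_gldim_le (n : nat) : Prop :=
  forall M : lmodType R, pdim_le M n.

End HomologicalDimension.

(* For two-sided noetherian rings, in particular for finite-dimensional        *)
(* algebras, the left and right global dimensions coincide. Both are required  *)
(* to be infinite, so that no choice of side is involved.                      *)
Definition infinite_gldim (R : nzRingType) : Prop :=
  (forall n, ~ left_gldim_le R n) /\ (forall n, ~ left_gldim_le R^c n).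

Section Homotope.

Import VectorInternalTheory.

Variables (k : fieldType) (A : falgType k).

Definition homotope_mul (Delta a b : A) : A := a * Delta * b.

(* AugHomotope Delta c a stands for c 1 + a.                                   *)
Record aug_homotope (Delta : A) := AugHomotope
  { aug_scalar : k; aug_elt : A }.

Variable Delta : A.
Local Notation B := (aug_homotope Delta).
Local Notation "<< c , a >>" := (@AugHomotope Delta c a) : ring_scope.

Fact aug_pairK :
  cancel (fun u : B => (aug_scalar u, aug_elt u)) (fun p => <<p.1, p.2>>).
Proof. by case. Qed.
HB.instance Definition _ := Choice.copy B (can_type aug_pairK).

Definition aug_zero : B := <<0, 0>>.
Definition aug_opp (u : B) : B := <<- aug_scalar u, - aug_elt u>>.
Definition aug_add (u v : B) : B :=
  <<aug_scalar u + aug_scalar v, aug_elt u + aug_elt v>>.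

Fact aug_addA : associative aug_add.
Proof. by move=> [a x] [b y] [c z]; rewrite /aug_add /= !addrA. Qed.
Fact aug_addC : commutative aug_add.
Proof.
by move=> [a x] [b y]; rewrite /aug_add /= [a + b]addrC [x + y]addrC.
Qed.
Fact aug_add0 : left_id aug_zero aug_add.
Proof. by case=> a x; rewrite /aug_add /= !add0r. Qed.
Fact aug_addN : left_inverse aug_zero aug_opp aug_add.
Proof. by case=> a x; rewrite /aug_add /= !addNr. Qed.

HB.instance Definition _ := GRing.isZmodule.Build B
  aug_addA aug_addC aug_add0 aug_addN.

Definition aug_scale (a : k) (u : B) : B :=
  <<a * aug_scalar u, a *: aug_elt u>>.

Fact aug_scaleA a b u : aug_scale a (aug_scale b u) = aug_scale (a * b) u.
Proof. by rewrite /aug_scale /= mulrA scalerA. Qed.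
Fact aug_scale1 : left_id 1 aug_scale.
Proof. by case=> a x; rewrite /aug_scale /= mul1r scale1r. Qed.
Fact aug_scaleDr : right_distributive aug_scale +%R.
Proof. by move=> a u v; congr AugHomotope; rewrite ?mulrDr ?scalerDr. Qed.
Fact aug_scaleDl u : {morph aug_scale^~ u : a b / a + b}.
Proof. by move=> a b; congr AugHomotope; rewrite ?mulrDl ?scalerDl. Qed.

HB.instance Definition _ := GRing.Zmodule_isLmodule.Build k B
  aug_scaleA aug_scale1 aug_scaleDr aug_scaleDl.

Fact aug_vect_iso : Vector.axiom (1 + dim A) B.
Proof.
exists (fun u => row_mx (aug_scalar u)%:M (v2r (aug_elt u))).
  move=> a u v; rewrite scale_row_mx add_row_mx linearP.
  by rewrite scale_scalar_mx raddfD.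
exists (fun w => <<lsubmx w 0 0, r2v (rsubmx w)>>) => [[c a]|w] /=.
  rewrite row_mxKl row_mxKr mxE eqxx mulr1n.
  by congr AugHomotope; apply: v2rK.
rewrite -[RHS]hsubmxK r2vK; congr row_mx.
by rewrite -mx11_scalar.
Qed.
HB.instance Definition _ := Lmodule_hasFinDim.Build k B aug_vect_iso.

Definition aug_one : B := <<1, 0>>.
Definition aug_mul (u v : B) : B :=
  <<aug_scalar u * aug_scalar v,
    aug_scalar u *: aug_elt v + aug_scalar v *: aug_elt u
      + homotope_mul Delta (aug_elt u) (aug_elt v)>>.

Fact aug_mulA : associative aug_mul.
Proof.
move=> [a x] [b y] [c z]; rewrite /aug_mul /homotope_mul /=.
congr AugHomotope; first by rewrite mulrA.
rewrite !(mulrDl, mulrDr, scalerDr) -!(scalerAl, scalerAr) !scalerA !mulrA.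
rewrite [c * a]mulrC [c * b]mulrC !addrA.
by rewrite [LHS](ACl (1 * 2 * 4 * 6 * 3 * 5 * 7)%AC).
Qed.

Fact aug_mul1 : left_id aug_one aug_mul.
Proof.
case=> b y; rewrite /aug_mul /homotope_mul /=.
by rewrite !mul1r scale1r scaler0 !mul0r !addr0.
Qed.

Fact aug_mulr1 : right_id aug_one aug_mul.
Proof.
case=> b y; rewrite /aug_mul /homotope_mul /=.
by rewrite mulr1 scale1r scaler0 mulr0 add0r addr0.
Qed.

Fact aug_mulDl : left_distributive aug_mul +%R.
Proof.
move=> [a x] [b y] [c z]; congr AugHomotope => /=; first by rewrite mulrDl.
rewrite /homotope_mul !mulrDl scalerDl scalerDr !addrA.
by rewrite [RHS](ACl (1 * 4 * 2 * 5 * 3 * 6)%AC).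
Qed.

Fact aug_mulDr : right_distributive aug_mul +%R.
Proof.
move=> [a x] [b y] [c z]; congr AugHomotope => /=; first by rewrite mulrDr.
rewrite /homotope_mul !mulrDr scalerDl scalerDr !addrA.
by rewrite [RHS](ACl (1 * 4 * 2 * 5 * 3 * 6)%AC).
Qed.

Fact aug_one_neq0 : aug_one != 0.
Proof. by apply/eqP=> -[] /eqP; rewrite oner_eq0. Qed.

HB.instance Definition _ := GRing.Zmodule_isNzRing.Build B
  aug_mulA aug_mul1 aug_mulr1 aug_mulDl aug_mulDr aug_one_neq0.

Fact aug_scaleAl (a : k) (u v : B) : a *: (u * v) = a *: u * v.
Proof.
case: u v => [b x] [c y]; congr AugHomotope => /=; first by rewrite mulrA.
by rewrite /homotope_mul !scalerDr -!scalerAl !scalerA [a * c]mulrC.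
Qed.

HB.instance Definition _ := GRing.Lmodule_isLalgebra.Build k B aug_scaleAl.

Fact aug_scaleAr (a : k) (u v : B) : a *: (u * v) = u * (a *: v).
Proof.
case: u v => [b x] [c y]; congr AugHomotope => /=; first by rewrite mulrCA.
by rewrite /homotope_mul !scalerDr -!scalerAr !scalerA [a * b]mulrC.
Qed.

HB.instance Definition _ := GRing.Lalgebra_isAlgebra.Build k B aug_scaleAr.
HB.instance Definition _ := Algebra_isFalgebra.Build k B.

Definition aug_eps (u : B) : k := aug_scalar u.

Fact aug_eps_is_linear : linear_for *%R aug_eps.
Proof. by []. Qed.
HB.instance Definition _ := GRing.isLinear.Build k B k _ aug_eps
  aug_eps_is_linear.

Fact aug_eps_is_monoid_morphism : monoid_morphism aug_eps.
Proof. by []. Qed.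
HB.instance Definition _ := GRing.isMonoidMorphism.Build B k aug_eps
  aug_eps_is_monoid_morphism.

Definition aug_ideal : {pred B} := [pred u | aug_eps u == 0].

Definition aug_ideal_l : {pred B^o} := aug_ideal.
Fact aug_ideal_l_submod : submod_closed aug_ideal_l.
Proof.
split=> [|b u v /eqP u0 /eqP v0]; first exact/eqP.
apply/eqP; change (aug_eps (b * (u : B) + v) = 0).
by rewrite rmorphD rmorphM /= u0 v0 mulr0 addr0.
Qed.
HB.instance Definition _ := GRing.isSubmodClosed.Build B B^o aug_ideal_l
  aug_ideal_l_submod.

Definition aug_ideal_r : {pred (B^c)^o} := aug_ideal.
Fact aug_ideal_r_submod : submod_closed aug_ideal_r.
Proof.
split=> [|b u v /eqP u0 /eqP v0]; first exact/eqP.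
apply/eqP; change (aug_eps ((u : B) * (b : B) + v) = 0).
by rewrite rmorphD rmorphM /= u0 v0 mul0r addr0.
Qed.
HB.instance Definition _ := GRing.isSubmodClosed.Build B^c (B^c)^o aug_ideal_r
  aug_ideal_r_submod.

Record aug_ideal_lmod := AugIdealL
  { aug_ideal_lval : B^o; _ : aug_ideal_lval \in aug_ideal_l }.
HB.instance Definition _ := [isSub for aug_ideal_lval].
HB.instance Definition _ := [Choice of aug_ideal_lmod by <:].
HB.instance Definition _ := [SubChoice_isSubZmodule of aug_ideal_lmod by <:].
HB.instance Definition _ := [SubZmodule_isSubLmodule of aug_ideal_lmod by <:].

Record aug_ideal_rmod := AugIdealR
  { aug_ideal_rval : (B^c)^o; _ : aug_ideal_rval \in aug_ideal_r }.
HB.instance Definition _ := [isSub for aug_ideal_rval].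
HB.instance Definition _ := [Choice of aug_ideal_rmod by <:].
HB.instance Definition _ := [SubChoice_isSubZmodule of aug_ideal_rmod by <:].
HB.instance Definition _ := [SubZmodule_isSubLmodule of aug_ideal_rmod by <:].

(* The last clause is A Delta A = A, where A Delta A is the linear span of the *)
(* products a Delta b, i.e. the image of the multiplication map                *)
(* B^+ (x) B^+ -> B^+.                                                         *)
Definition well_tempered : Prop :=
  [/\ projective (aug_ideal_lmod : lmodType B),
      projective (aug_ideal_rmod : lmodType B^c)
    & ({:A} * <[Delta]> * {:A})%VS = {:A}%VS].

End Homotope.

(* Main.v *)
(* If A Delta A = A, write 1 = sum_i a_i Delta b_i; then x |-> (x a_i)_i      *)
(* splits the map (u_i)_i |-> sum_i u_i b_i from B^n onto B^+, so B^+ is      *)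
(* projective (on both sides), and Delta is well-tempered. Hence the          *)
(* hypothesis means that A Delta A is a proper ideal of A. It contains all    *)
(* commutators of B, so c + a |-> a mod A Delta A is a trace on B. If X^n     *)
(* g(X) annihilates Delta, with g(0) <> 0, then g(Delta) is nilpotent in the  *)
(* homotope and congruent to g(0) modulo A Delta A: the trace does not vanish *)
(* on some nilpotent element. By an argument of Lenzing this is impossible in *)
(* finite global dimension: a trace on B extends to endomorphisms of finitely *)
(* generated modules of finite projective dimension, with tr(gh) = tr(hg), so *)
(* that right multiplication by y has the same trace on all the left ideals B *)
(* y^i, the first of which is B and the last of which is 0.                   *)

Require Import Defs.
From HB Require Import structures.
From mathcomp Require Import all_boot all_order all_algebra all_field.
From mathcomp Require Import boolp.

Set Implicit Arguments.
Unset Strict Implicit.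
Unset Printing Implicit Defensive.

Import GRing.Theory.
Local Open Scope ring_scope.

(** Since A Delta A = A makes Delta well-tempered ([prodv_homotope_well_tempered]), here A Delta A
    is proper, and [aug_nilpotent] gives a nilpotent y in B with nonzero trace.
    [gldim_trace_nilpotent] excludes this in finite global dimension. The argument is carried out
    with matrices: a finitely generated submodule of R^q is the row space of some Z, its syzygy is
    the row space of a D whose rows generate the left kernel of Z, and an endomorphism is given by a
    matrix acting on the generators. [gldim_reg_syzygy] turns a bound on the global dimension into
    finite chains of such matrices ending in a splitting, along which [has_trace] takes alternating
    sums. Its symmetry [has_traceC] lets [trace_nilpotent] carry tau(y) from R down to R y^m = 0. *)

Section MatrixSyzygies.

(** * Syzygies of matrices and the trace of an endomorphism *)

Variable R : nzRingType.

Definition exact_mx c p q (D : 'M[R]_(c, p)) (Z : 'M[R]_(p, q)) : Prop :=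
  forall v : 'rV_p, v *m Z = 0 <-> exists w, v = w *m D.

Definition has_fin_kernels : Prop :=
  forall p q (Z : 'M[R]_(p, q)), exists c (D : 'M[R]_(c, p)), exact_mx D Z.

Lemma exact_mx_comp c p q (D : 'M[R]_(c, p)) (Z : 'M[R]_(p, q)) :
  exact_mx D Z -> D *m Z = 0.
Proof.
move=> DZ; apply/row_matrixP=> i; rewrite row_mul row0; apply/DZ.
by exists (delta_mx 0 i); rewrite -rowE.
Qed.

Lemma exact_mx_factor r c p q (X : 'M[R]_(r, p))
    (D : 'M[R]_(c, p)) (Z : 'M[R]_(p, q)) :
  exact_mx D Z -> X *m Z = 0 -> exists W, X = W *m D.
Proof.
move=> DZ XZ0.
have /fin_all_exists[f fP] i : exists w, row i X = w *m D.
  by apply/DZ; rewrite -row_mul XZ0 row0.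
exists (\matrix_i f i); apply/row_matrixP=> i.
by rewrite row_mul rowK.
Qed.

Lemma exact_mx_lift c p q c' p' q' (D : 'M[R]_(c, p)) (Z : 'M[R]_(p, q))
    (D' : 'M[R]_(c', p')) (Z' : 'M[R]_(p', q')) (G : 'M[R]_(p, p')) :
  exact_mx D Z -> exact_mx D' Z' ->
  (forall v : 'rV_p, v *m Z = 0 -> v *m G *m Z' = 0) ->
  exists G', D *m G = G' *m D'.
Proof.
move=> DZ DZ' kerG; apply: exact_mx_factor DZ' _.
apply/row_matrixP=> i; rewrite row0 !row_mul; apply: kerG.
by rewrite -row_mul (exact_mx_comp DZ) row0.
Qed.

(* The row space of [Z] has projective dimension at most [n].                 *)
Fixpoint reg_syzygy n p q (Z : 'M[R]_(p, q)) : Prop :=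
  if n is n'.+1 then
    exists c (D : 'M[R]_(c, p)), exact_mx D Z /\ reg_syzygy n' D
  else exists S, Z *m S *m Z = Z.

Section Trace.

Variables (V : zmodType) (tau : {additive R -> V}).
Hypothesis tauC : forall a b, tau (a * b) = tau (b * a).

Lemma tau_mxtraceC p q (X : 'M[R]_(p, q)) (Y : 'M[R]_(q, p)) :
  tau (\tr (X *m Y)) = tau (\tr (Y *m X)).
Proof.
rewrite /mxtrace !raddf_sum /=.
under eq_bigr do rewrite mxE raddf_sum.
rewrite exchange_big; apply: eq_bigr => j _ /=.
by rewrite mxE raddf_sum; apply: eq_bigr => i _; rewrite tauC.
Qed.

(* The endomorphism of the row space of [Z] lifted by [F] has trace [t], the  *)
(* alternating sum of the traces of its lifts to a resolution.                *)
Fixpoint has_trace n p q (Z : 'M[R]_(p, q)) (F : 'M[R]_p) (t : V) : Prop :=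
  if n is n'.+1 then
    exists c (D : 'M[R]_(c, p)) F' t',
      [/\ exact_mx D Z, F' *m D = D *m F, has_trace n' D F' t'
        & t = tau (\tr F) - t']
  else exists2 S, Z *m S *m Z = Z & t = tau (\tr (F *m Z *m S)).

(** H acts as a homotopy: D H is its effect on the syzygy and H D its effect one degree lower. The
    two traces agree, so they cancel in the alternating sum of [has_trace_ext]. *)
Lemma has_trace_factor n c p (D : 'M[R]_(c, p)) F (H : 'M[R]_(p, c)) t :
  has_trace n D F t -> has_trace n D (F + D *m H) (t + tau (\tr (H *m D))).
Proof.
case: n => [|n] /= => [[S DSD ->]|[e [E [F' [t' [ED F'E F't' ->]]]]]].
  exists S => //; rewrite !mulmxDl !raddfD /=; congr (_ + _).
  by rewrite -!mulmxA [RHS]tau_mxtraceC -!mulmxA (mulmxA D S) DSD.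
exists e, E, F', t'; split=> //.
  by rewrite F'E mulmxDr mulmxA (exact_mx_comp ED) mul0mx addr0.
by rewrite !raddfD /= addrAC (tau_mxtraceC H).
Qed.

Lemma has_trace_ext n p q (Z : 'M[R]_(p, q)) F1 F2 t :
  F1 *m Z = F2 *m Z -> has_trace n Z F1 t -> has_trace n Z F2 t.
Proof.
case: n => [|n] /= eqF => [[S ZSZ ->]|[c [D [F' [t' [DZ F'D F't' ->]]]]]].
  by exists S; rewrite -?eqF.
have [|H dF] := exact_mx_factor (X := F2 - F1) DZ.
  by rewrite mulmxBl eqF subrr.
exists c, D, (F' + D *m H), (t' + tau (\tr (H *m D))); split=> //.
- by rewrite mulmxDl F'D -mulmxA -dF mulmxBr addrC subrK.
- exact: has_trace_factor.
by rewrite -dF !raddfB /= opprD opprB addrCA [X in _ = _ + X]addrC subrK addrC.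
Qed.

(** With Z' = Z and H = 1 this is independence of the chosen syzygies and lifts. In degree zero tau
    is symmetric; on the syzygies, lifts G' and H' of G and H give G' H' and H' G', which may
    replace the chosen lifts by [has_trace_ext]. *)
Lemma has_traceC n p q p' q' (Z : 'M[R]_(p, q)) (Z' : 'M[R]_(p', q'))
    (G : 'M[R]_(p, p')) (H : 'M[R]_(p', p)) t t' :
  (forall v : 'rV_p, v *m Z = 0 -> v *m G *m Z' = 0) ->
  (forall v : 'rV_p', v *m Z' = 0 -> v *m H *m Z = 0) ->
  has_trace n Z (G *m H) t -> has_trace n Z' (H *m G) t' -> t = t'.
Proof.
elim: n p q p' q' Z Z' G H t t' => [|n IHn] p q p' q' Z Z' G H t t' kerG kerH
  /=.
  (* The rows of Z1 S - 1 lie in the left kernel of Z1. *)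
  have mul_split p1 q1 p2 q2 (Z1 : 'M[R]_(p1, q1)) (Z2 : 'M[R]_(p2, q2))
      (K : 'M[R]_(p1, p2)) S :
      (forall v : 'rV_p1, v *m Z1 = 0 -> v *m K *m Z2 = 0) ->
      Z1 *m S *m Z1 = Z1 -> Z1 *m S *m K *m Z2 = K *m Z2.
    move=> kerK ZSZ; apply/eqP; rewrite -subr_eq0 -!mulmxBl; apply/eqP.
    rewrite -[X in _ - X]mul1mx -!mulmxBl.
    apply/row_matrixP=> i; rewrite !row_mul row0 kerK // -row_mul.
    by rewrite mulmxBl ZSZ mul1mx subrr row0.
  case=> S ZSZ -> [S' ZSZ' ->].
  rewrite -(mulmxA G H Z) -(mul_split _ _ _ _ _ _ _ _ kerH ZSZ').
  rewrite -(mulmxA H G Z') -(mul_split _ _ _ _ _ _ _ _ kerG ZSZ).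
  transitivity (tau (\tr ((G *m Z' *m S') *m (H *m Z *m S)))).
    by rewrite -!mulmxA.
  by rewrite tau_mxtraceC -!mulmxA.
case=> c [D [F [s [DZ FD Fs ->]]]] [c' [D' [F' [s' [DZ' FD' Fs' ->]]]]].
rewrite tau_mxtraceC; congr (_ - _).
have [G' G'D] := exact_mx_lift DZ DZ' kerG.
have [H' H'D] := exact_mx_lift DZ' DZ kerH.
apply: (IHn _ _ _ _ D D' G' H').
- by move=> v v0; rewrite -mulmxA -G'D mulmxA v0 mul0mx.
- by move=> v v0; rewrite -mulmxA -H'D mulmxA v0 mul0mx.
- by apply: has_trace_ext Fs; rewrite FD -mulmxA -H'D mulmxA G'D mulmxA.
by apply: has_trace_ext Fs'; rewrite FD' -mulmxA -G'D mulmxA H'D mulmxA.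
Qed.

Lemma has_trace_exists n p q (Z : 'M[R]_(p, q)) F :
  reg_syzygy n Z -> (forall v : 'rV_p, v *m Z = 0 -> v *m F *m Z = 0) ->
  exists t, has_trace n Z F t.
Proof.
elim: n p q Z F => [|n IHn] p q Z F /=.
  by case=> S ZSZ _; exists (tau (\tr (F *m Z *m S))), S.
case=> c [D [DZ regD]] kerF; have [F' F'D] := exact_mx_lift DZ DZ kerF.
have [|t F't] := IHn _ _ _ F' regD.
  by move=> v v0; rewrite -mulmxA -F'D mulmxA v0 mul0mx.
by exists (tau (\tr F) - t), c, D, F', t.
Qed.

(** The two claims need a joint induction: 0 is a syzygy matrix of 1, and 1 is one of 0. *)
Lemma has_trace_free n p (F : 'M[R]_p) :
  has_trace n 1%:M F (tau (\tr F)) /\ has_trace n (0 : 'M[R]_p) F 0.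
Proof.
elim: n F => [|n IHn] F /=.
  split; first by exists 1%:M; rewrite !mulmx1.
  by exists 0; rewrite ?mul0mx // mulmx0 !raddf0.
split.
  exists p, 0, 0, 0; split; rewrite ?mul0mx ?subr0 //; last by have [] := IHn 0.
  move=> v; rewrite mulmx1; split=> [->|[w ->]]; last exact: mulmx0.
  by exists 0; rewrite mulmx0.
exists p, 1%:M, F, (tau (\tr F)); split; rewrite ?mul1mx ?mulmx1 ?subrr //.
  by move=> v; rewrite mulmx0; split=> // _; exists v; rewrite mulmx1.
by have [] := IHn F.
Qed.

(* The map [y] on [R y^i] and on [R y^i.+1] is [g h] and [h g] for            *)
(* [g : R y^i -> R y^i.+1], right multiplication by [y], and the inclusion    *)
(* [h], so that the trace does not depend on [i].                             *)
Lemma trace_nilpotent n m (y : R) :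
  (forall i, reg_syzygy n ((y ^+ i)%:M : 'M_1)) -> y ^+ m = 0 -> tau y = 0.
Proof.
move=> regy ym0; pose Z i : 'M[R]_1 := (y ^+ i)%:M.
have ker1 i (v : 'rV[R]_1) : v *m Z i = 0 -> v *m 1%:M *m Z i.+1 = 0.
  by move=> v0; rewrite mulmx1 /Z exprSr scalar_mxM mulmxA v0 mul0mx.
have kery i (v : 'rV[R]_1) : v *m Z i.+1 = 0 -> v *m y%:M *m Z i = 0.
  by rewrite -mulmxA -scalar_mxM -exprS.
have [tr1 _] := has_trace_free n (y%:M : 'M[R]_1).
have [_ tr0] := has_trace_free n (y%:M : 'M[R]_1).
suffices tr_y i : has_trace n (Z i) y%:M (tau y).
  have := tr_y m; rewrite /Z ym0 raddf0 -[y%:M]mulmx1 => tr_m.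
  apply: (has_traceC (Z' := 0 : 'M[R]_1) _ _ tr_m); rewrite ?mul1mx // => v.
    by rewrite !mulmx0.
  by rewrite !mulmx0.
elim: i => [|i tr_i]; first by move: tr1; rewrite mxtrace_scalar mulr1n.
have [|t tr_t] := has_trace_exists (F := y%:M) (regy i.+1).
  by move=> v /kery v0; rewrite -/(Z _) /Z exprSr scalar_mxM mulmxA v0 mul0mx.
suff -> : tau y = t by [].
by apply: (has_traceC (n := n) (ker1 i) (kery i)); rewrite ?mul1mx ?mulmx1.
Qed.

End Trace.

End MatrixSyzygies.

(** * Images of linear maps as modules *)

Section ImageModule.

Variables (R : nzRingType) (L N : lmodType R) (f : {linear L -> N}).

Definition im_pred : {pred N} := fun y => `[< exists x, f x = y >].

Fact im_pred_submod : submod_closed im_pred.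
Proof.
split=> [|a _ _ /asboolP[x <-] /asboolP[y <-]]; apply/asboolP.
  by exists 0; rewrite linear0.
by exists (a *: x + y); rewrite linearP.
Qed.
HB.instance Definition _ := GRing.isSubmodClosed.Build R N im_pred
  im_pred_submod.

Record im_mod := ImMod { im_val : N; _ : im_val \in im_pred }.
HB.instance Definition _ := [isSub for im_val].
HB.instance Definition _ := [Choice of im_mod by <:].
HB.instance Definition _ := [SubChoice_isSubZmodule of im_mod by <:].
HB.instance Definition _ := [SubZmodule_isSubLmodule of im_mod by <:].

Variables (P : lmodType R) (g : {linear P -> N}).
Hypothesis im_g : forall x, exists y, f y = g x.

Definition corestr (x : P) : im_mod := ImMod (asboolT (im_g x)).
Fact corestr_is_linear : linear corestr.
Proof. by move=> a x y; apply: val_inj; rewrite /= linearP. Qed.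
HB.instance Definition _ := GRing.isLinear.Build R P im_mod _ corestr
  corestr_is_linear.

End ImageModule.

(** * From projective resolutions to chains of matrices *)

Section Projective.

Variable R : nzRingType.

Lemma projective_lift (P L N : lmodType R) (f : {linear L -> N})
    (g : {linear P -> N}) :
  projective P -> (forall x, exists y, f y = g x) ->
  exists h : {linear P -> L}, forall x, f (h x) = g x.
Proof.
move=> projP im_g; have im_f x : exists y, f y = f x by exists x.
have [|h hP] := projP _ _ (corestr im_f) (corestr im_g).
  by case=> y /[dup] /asboolP[x fx] yf; exists x; apply: val_inj.
by exists h => x; have /(congr1 (@im_val _ _ _ f)) := hP x.
Qed.

Definition row_comb p (M : lmodType R) (m : 'I_p -> M) (v : 'rV[R]_p) : M :=
  \sum_i v 0 i *: m i.
Fact row_comb_is_linear p (M : lmodType R) (m : 'I_p -> M) :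
  linear (@row_comb p M m).
Proof.
move=> a u v; rewrite scaler_sumr -big_split; apply: eq_bigr => i _ /=.
by rewrite !mxE scalerDl scalerA.
Qed.
HB.instance Definition _ p (M : lmodType R) (m : 'I_p -> M) :=
  GRing.isLinear.Build R 'rV[R]_p M _
  (@row_comb p M m) (@row_comb_is_linear p M m).

Lemma projective_row p : projective ('rV[R]_p : lmodType R).
Proof.
move=> M N g f g_surj.
have /fin_all_exists[m mP] i : exists x, g x = f (delta_mx 0 i) by [].
exists (row_comb m) => v; rewrite [in RHS](row_sum_delta v) !linear_sum.
by apply: eq_bigr => i _; rewrite !linearZ_LR mP.
Qed.

Section Comparison.

Hypothesis fink : has_fin_kernels R.
Variables (M : lmodType R) (r : proj_resolution M).

Let res_bdry i (x : res_mod r i) : Prop := exists y, res_diff r i y = x.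

(** The modules of [r] need not be finitely generated, so [r] is compared with the matrix chain:
    [al] and [be] are comparison maps in degree i, and [h] is a homotopy between their composite and
    the identity, required only on the kernel of Z. Where [r] vanishes, the homotopy splits the
    chain. *)
Lemma reg_syzygy_comparison d i p q c (Z : 'M[R]_(p, q)) (D : 'M[R]_(c, p))
    (al : {linear 'rV[R]_p -> res_mod r i})
    (be : {linear res_mod r i -> 'rV[R]_p})
    (h : {linear 'rV[R]_p -> 'rV[R]_c}) :
  (forall j, (i + d <= j)%N -> forall x : res_mod r j, x = 0) ->
  exact_mx D Z ->
  (forall v, v *m Z = 0 -> res_bdry (al v)) ->
  (forall x, res_bdry x -> be x *m Z = 0) ->
  (forall v, v *m Z = 0 -> v - be (al v) = h v *m D) ->
  reg_syzygy d.+1 Z.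
Proof.
elim: d i p q c Z D al be h => [|d IHd] i p q c Z D al be h r0 DZ alZ beZ hZ.
  (* As [al] is zero, the homotopy equation on the rows of D reads D = D h D. *)
  exists c, D; split=> //; exists (lin1_mx h); apply/row_matrixP=> j.
  have DjZ : row j D *m Z = 0 by rewrite -row_mul (exact_mx_comp DZ) row0.
  have alD0 : al (row j D) = 0 by apply: r0; rewrite addn0.
  by rewrite !row_mul mul_rV_lin1 -hZ // alD0 linear0 subr0.
have [e [E ED]] := fink D.
have imD (w : 'rV_c) : w *m D *m Z = 0.
  by rewrite -mulmxA (exact_mx_comp DZ) mulmx0.
have [al' al'P] : exists al' : {linear 'rV[R]_c -> res_mod r i.+1},
    forall w, res_diff r i (al' w) = (al \o mulmxr D) w.
  by apply: projective_lift => [|w]; [exact: projective_row|exact: alZ (imD w)].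
have [be' be'P] : exists be' : {linear res_mod r i.+1 -> 'rV[R]_c},
    forall y, mulmxr D (be' y) = (be \o res_diff r i) y.
  apply: projective_lift => [|y]; first exact: res_projective.
  have /DZ[w wE] : be (res_diff r i y) *m Z = 0 by apply: beZ; exists y.
  by exists w; rewrite /= wE.
(* The full homotopy equation; its term in [h] vanishes on the kernel of D. *)
have [h' h'P] : exists h' : {linear 'rV[R]_c -> 'rV[R]_e},
    forall w, mulmxr E (h' w) = (idfun \- (be' \o al') \- (h \o mulmxr D)) w.
  apply: projective_lift => [|w]; first exact: projective_row.
  suff /ED[u uE] : (w - be' (al' w) - h (w *m D)) *m D = 0.
    by exists u; rewrite /= -uE.
  have /= be'E := be'P (al' w); rewrite !mulmxBl be'E al'P /= -hZ //.
  by rewrite subrr.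
exists c, D; split=> //; apply: (IHd i.+1 _ _ _ D E al' be' h') => //.
- by move=> j; rewrite addSnnS; apply: r0.
- move=> v v0; apply/res_exactS.
  by rewrite al'P /= v0 linear0.
- move=> x x_bdry; have x0 : res_diff r i x = 0 by apply/res_exactS.
  by have /= -> := be'P x; rewrite x0 linear0.
by move=> v v0; have /= -> := h'P v; rewrite v0 linear0 subr0.
Qed.

End Comparison.

(** The resolution of the row space vanishes from degree n + 1 on, and the matrix that splits is one
    syzygy further. *)
Lemma gldim_reg_syzygy n p q (Z : 'M[R]_(p, q)) :
  has_fin_kernels R -> left_gldim_le R n -> reg_syzygy n.+2 Z.
Proof.
move=> fink /(_ (im_mod (mulmxr Z : {linear 'rV[R]_p -> 'rV[R]_q})))[r rn].
have imZ (v : 'rV_p) : exists u, mulmxr Z u = mulmxr Z v by exists v.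
have ZE (v : 'rV_p) : v *m Z = 0 <-> corestr imZ v = 0.
  by split=> [v0|/(congr1 val)//]; apply: val_inj.
have [al alP] : exists al : {linear 'rV[R]_p -> res_mod r 0},
    forall v, res_aug r (al v) = corestr imZ v.
  apply: projective_lift => [|v]; first exact: projective_row.
  exact: res_aug_surj.
have [be beP] : exists be : {linear res_mod r 0 -> 'rV[R]_p},
    forall x, corestr imZ (be x) = res_aug r x.
  apply: projective_lift => [|x]; first exact: res_projective.
  case: (res_aug r x) => y /[dup] /asboolP[v vZ] yZ.
  by exists v; apply: val_inj.
have [c [D DZ]] := fink _ _ Z.
have [h hP] : exists h : {linear 'rV[R]_p -> 'rV[R]_c},
    forall v, mulmxr D (h v) = (idfun \- (be \o al)) v.
  apply: projective_lift => [|v]; first exact: projective_row.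
  suff /DZ[u uE] : (v - be (al v)) *m Z = 0 by exists u; rewrite /= -uE.
  by apply/ZE; rewrite linearB /= beP alP subrr.
apply: (reg_syzygy_comparison fink (D := D) (al := al) (be := be) (h := h)) =>
  //.
- by move=> v /ZE v0; apply/res_exact0; rewrite alP.
- by move=> x /res_exact0 x0; apply/ZE; rewrite beP.
by move=> v _; have /= -> := hP v.
Qed.

End Projective.

(* Lenzing's theorem; the usual additivity of the trace is not needed.        *)
Lemma gldim_trace_nilpotent (R : nzRingType) (V : zmodType)
    (tau : {additive R -> V}) n m (y : R) :
  has_fin_kernels R -> left_gldim_le R n ->
  (forall a b, tau (a * b) = tau (b * a)) -> y ^+ m = 0 -> tau y = 0.
Proof.
move=> fink gld tauC; apply: (trace_nilpotent tauC (n := n.+2)) => i.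
exact: gldim_reg_syzygy.
Qed.

(** * Finite generation of kernels over finite-dimensional algebras *)

(** Scalars act through left multiplication by [z c], so a left kernel is a subspace of V^p and a
    basis of it generates it over R. Passing through [phi] serves both B and its opposite ring. *)
Lemma fin_kernels_vect (k : fieldType) (V : vectType k) (R : nzRingType)
    (phi : {additive V -> R}) (psi : R -> V) (z : k -> R) :
  cancel phi psi -> cancel psi phi ->
  (forall c x, phi (c *: x) = z c * phi x) -> has_fin_kernels R.
Proof.
move=> phiK psiK phiZ p q Z.
pose f (u : {ffun 'I_p -> V}) : {ffun 'I_q -> V} :=
  [ffun j => psi (\sum_i phi (u i) * Z i j)].
have f_lin : linear f.
  move=> c u v; apply/ffunP=> j; rewrite !ffunE; apply: (can_inj phiK).
  rewrite raddfD /= phiZ !psiK mulr_sumr -big_split; apply: eq_bigr => i _ /=.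
  by rewrite !ffunE raddfD /= phiZ mulrDl mulrA.
pose fL : {linear {ffun 'I_p -> V} -> {ffun 'I_q -> V}} :=
  HB.pack f (GRing.isLinear.Build _ _ _ _ f f_lin).
pose K := lker (linfun fL); pose b := vbasis K.
have memK u : (u \in K) = (f u == 0) by rewrite memv_ker lfunE.
pose row_of (u : {ffun 'I_p -> V}) : 'rV[R]_p := \row_j phi (u j).
have row_ofZ u : (row_of u *m Z == 0) = (u \in K).
  have rowE j : (row_of u *m Z) 0 j = phi (f u j).
    by rewrite mxE ffunE psiK; apply: eq_bigr => i _; rewrite mxE.
  rewrite memK; apply/eqP/eqP => [/rowP uZ|fu0].
    apply/ffunP=> j; apply: (can_inj phiK).
    by rewrite -rowE uZ ffunE !raddf0 mxE.
  by apply/rowP=> j; rewrite rowE fu0 ffunE raddf0 mxE.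
pose D : 'M[R]_(\dim K, p) := \matrix_i row_of b`_i.
exists (\dim K), D => v; split=> [vZ|[w ->]]; last first.
  suff DZ : D *m Z = 0 by rewrite -mulmxA DZ mulmx0.
  apply/row_matrixP=> i; rewrite row_mul rowK row0; apply/eqP.
  by rewrite row_ofZ; apply/vbasis_mem/mem_nth; rewrite size_tuple.
pose u := [ffun j => psi (v 0 j)].
have vE : v = row_of u by apply/rowP=> j; rewrite mxE ffunE psiK.
have uK : u \in K by rewrite -row_ofZ -vE vZ.
exists (\row_i z (coord b i u)); apply/rowP=> j.
rewrite vE mxE (coord_vbasis uK) sum_ffunE raddf_sum mxE; apply: eq_bigr => i _.
by rewrite !mxE -(coord_vbasis uK) ffunE phiZ.
Qed.

(** * The augmented homotope *)

Section HomotopeLemmas.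

Variables (k : fieldType) (A : falgType k) (Delta : A).
Local Notation B := (aug_homotope Delta).
Local Notation AA := ({:A} * <[Delta]> * {:A})%VS.

Lemma aug_fin_kernels : has_fin_kernels B.
Proof.
apply: (@fin_kernels_vect k B B idfun id (fun c => c%:A)) => // c x /=.
by rewrite -scalerAl mul1r.
Qed.

Lemma aug_fin_kernels_op : has_fin_kernels B^c.
Proof.
apply: (@fin_kernels_vect k B B^c (idfun : {additive B -> B}) id
  (fun c => c%:A)) => // c x /=.
by change (c *: x = x * (c%:A : B)); rewrite -scalerAr mulr1.
Qed.

Lemma mem_prodv_homotope a b : a * Delta * b \in AA.
Proof. by rewrite !memv_mul ?memvf ?memv_line. Qed.

Lemma prodv_homotope_sum : AA = {:A}%VS ->
  exists n (a b : 'I_n -> A), \sum_i a i * Delta * b i = 1.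
Proof.
move=> AAE; pose W := ({:A} * <[Delta]>)%VS.
have WP u : u \in W -> exists a, u = a * Delta.
  have /subvP sW : (W <= limg (amulr Delta))%VS.
    apply/prodvP=> a _ _ /vlineP[c ->]; apply/memv_imgP.
    by exists (c *: a); rewrite ?memvf // lfunE /= -scalerAl -scalerAr.
  by move=> /sW/memv_imgP[a _ ->]; exists a; rewrite lfunE.
pose X := in_tuple [seq u * v | u <- vbasis W, v <- vbasis {:A}].
have X1 : 1 \in <<X>>%VS.
  have -> : <<X>>%VS = AA by rewrite /X /W /prodv !locked_withE.
  by rewrite AAE memvf.
have /fin_all_exists[ab abP] (i : 'I_(size X)) :
    exists ab : A * A, X`_i = ab.1 * Delta * ab.2.
  have /allpairsP[[u v] /= [/vbasis_mem/WP[a ->] _ ->]] :=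
    mem_nth 0 (ltn_ord i).
  by exists (a, v).
exists (size X), (fun i => coord X i 1 *: (ab i).1), (fun i => (ab i).2).
rewrite [RHS](coord_span X1); apply: eq_bigr => i _.
by rewrite abP -!scalerAl.
Qed.

Definition aug_in (x : A) : B := AugHomotope Delta 0 x.

Fact aug_in_is_linear : linear aug_in.
Proof. by move=> c x y; congr AugHomotope; rewrite /= mulr0 addr0. Qed.
HB.instance Definition _ := GRing.isLinear.Build k A B _ aug_in
  aug_in_is_linear.

Fact aug_elt_is_linear : linear (@aug_elt k A Delta).
Proof. by []. Qed.
HB.instance Definition _ := GRing.isLinear.Build k B A _ (@aug_elt k A Delta)
  aug_elt_is_linear.

Lemma aug_in_elt (u : B) : aug_eps u = 0 -> aug_in (aug_elt u) = u.
Proof. by case: u => c x /= ->. Qed.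

Lemma aug_inM x y : aug_in x * aug_in y = aug_in (x * Delta * y).
Proof. by congr AugHomotope; rewrite /= ?mul0r // !scale0r !add0r. Qed.

(** Right multiplication by y in A itself, without Delta, is an endomorphism of the left B-module
    B^+; this makes the splitting of B^+ linear. *)
Lemma aug_in_mull (u : B) x y :
  aug_in (aug_elt (u * aug_in x) * y) = u * aug_in (x * y).
Proof.
congr AugHomotope; rewrite /= ?mulr0 // !scale0r !addr0.
by rewrite /homotope_mul mulrDl !mulrA scalerAl.
Qed.

Lemma aug_in_mulr (u : B) x y :
  aug_in (y * aug_elt (aug_in x * u)) = aug_in (y * x) * u.
Proof.
congr AugHomotope; rewrite /= ?mul0r // !scale0r !add0r.
by rewrite /homotope_mul mulrDr !mulrA scalerAr.
Qed.

Section IdealProjective.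

Variables (n : nat) (a b : 'I_n -> A).
Hypothesis sum_ab : \sum_i a i * Delta * b i = 1.

Lemma aug_ideal_lmod_projective :
  projective (aug_ideal_lmod Delta : lmodType B).
Proof.
move=> M N g f g_surj.
have in_l x : aug_in x \in @aug_ideal_l k A Delta by apply/eqP.
(* With [m i] a lift of b_i, the lift of f sends u to the sum of the (u a_i) m_i, and u is the sum
   of the u a_i Delta b_i. *)
have /fin_all_exists[m mP] i : exists x, g x = f (AugIdealL (in_l (b i))) by [].
pose h (u : aug_ideal_lmod Delta) : M :=
  \sum_i aug_in (aug_elt (val u : B) * a i) *: m i.
have val_in (u : aug_ideal_lmod Delta) : aug_in (aug_elt (val u : B)) = val u.
  by apply: aug_in_elt; apply/eqP/(valP u).
have h_lin : linear h.
  move=> c u v; rewrite scaler_sumr -big_split; apply: eq_bigr => i _ /=.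
  rewrite scalerA -scalerDl; congr (_ *: _).
  change (aug_in (aug_elt ((c : B) * (val u : B) + val v) * a i) =
    (c : B) * aug_in (aug_elt (val u : B) * a i)
      + aug_in (aug_elt (val v : B) * a i)).
  by rewrite -aug_in_mull val_in -raddfD -mulrDl -raddfD.
exists (HB.pack_for {linear aug_ideal_lmod Delta -> M} h
  (GRing.isLinear.Build _ _ _ _ h h_lin)) => u /=.
rewrite linear_sum; under eq_bigr do rewrite linearZ_LR mP -linearZ_LR.
rewrite -linear_sum; congr (f _); apply: val_inj.
rewrite raddf_sum /= -[RHS]val_in.
transitivity (\sum_i aug_in (aug_elt (val u : B) * a i) * aug_in (b i)) => //.
under eq_bigr do rewrite aug_inM -!mulrA.
rewrite -raddf_sum -mulr_sumr; congr (aug_in _).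
under eq_bigr do rewrite mulrA.
by rewrite sum_ab mulr1.
Qed.

Lemma aug_ideal_rmod_projective :
  projective (aug_ideal_rmod Delta : lmodType B^c).
Proof.
move=> M N g f g_surj.
have in_r x : aug_in x \in @aug_ideal_r k A Delta by apply/eqP.
have /fin_all_exists[m mP] i : exists x, g x = f (AugIdealR (in_r (a i))) by [].
pose h (u : aug_ideal_rmod Delta) : M :=
  \sum_i (aug_in (b i * aug_elt (val u : B)) : B^c) *: m i.
have val_in (u : aug_ideal_rmod Delta) : aug_in (aug_elt (val u : B)) = val u.
  by apply: aug_in_elt; apply/eqP/(valP u).
have h_lin : linear h.
  move=> c u v; rewrite scaler_sumr -big_split; apply: eq_bigr => i _ /=.
  rewrite scalerA -scalerDl; congr (_ *: _).
  change (aug_in (b i * aug_elt ((val u : B) * (c : B) + val v)) =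
    aug_in (b i * aug_elt (val u : B)) * (c : B)
      + aug_in (b i * aug_elt (val v : B))).
  by rewrite -aug_in_mulr val_in -raddfD -mulrDr -raddfD.
exists (HB.pack_for {linear aug_ideal_rmod Delta -> M} h
  (GRing.isLinear.Build _ _ _ _ h h_lin)) => u /=.
rewrite linear_sum; under eq_bigr do rewrite linearZ_LR mP -linearZ_LR.
rewrite -linear_sum; congr (f _); apply: val_inj.
rewrite raddf_sum /= -[RHS]val_in.
transitivity (\sum_i aug_in (a i) * aug_in (b i * aug_elt (val u : B))) => //.
under eq_bigr do rewrite aug_inM mulrA.
by rewrite -raddf_sum -mulr_suml sum_ab mul1r.
Qed.

End IdealProjective.

Lemma prodv_homotope_well_tempered : AA = {:A}%VS -> well_tempered Delta.
Proof.
move=> AAE; have [n [a [b sum_ab]]] := prodv_homotope_sum AAE.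
split=> //; first exact: aug_ideal_lmod_projective sum_ab.
exact: aug_ideal_rmod_projective sum_ab.
Qed.

(** A complement of A Delta A in A, reached by a projection, stands for the quotient. *)
Definition aug_trace : B -> A := (\1 - projv AA)%VF \o @aug_elt k A Delta.
HB.instance Definition _ := GRing.Linear.on aug_trace.

Lemma aug_trace_eq0 u : (aug_trace u == 0) = (aug_elt u \in AA).
Proof.
rewrite /aug_trace /= add_lfunE opp_lfunE id_lfunE subr_eq0.
apply/eqP/idP => [->|?]; first exact: memv_proj.
by rewrite projv_id.
Qed.

Lemma aug_traceC u v : aug_trace (u * v) = aug_trace (v * u).
Proof.
apply/eqP; rewrite -subr_eq0 -raddfB aug_trace_eq0 raddfB /=.
rewrite (addrC _ (homotope_mul Delta (aug_elt u) _)).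
rewrite [X in _ - (X + _)]addrC addrKA.
by rewrite memvB ?mem_prodv_homotope.
Qed.

Lemma root_pfactor (F : fieldType) (p : {poly F}) : p != 0 ->
  exists n (g : {poly F}), g.[0] != 0 /\ p = g * 'X^n.
Proof.
move=> p0; have [n [g]] := multiplicity_XsubC p 0.
by rewrite p0 subr0 => g0 ->; exists n, g.
Qed.

Lemma falg_annihilator (x : A) :
  exists2 p : {poly k}, p != 0 & horner_alg x p = 0.
Proof.
pose d := (\dim {:A}).+1; pose X := [tuple x ^+ i | i < d].
have : ~~ free X.
  apply/negP; rewrite /free size_tuple => /eqP dX.
  by have := dimvS (subvf <<X>>); rewrite dX ltnn.
apply: contraNP => no_p; apply/freeP => c cX i.
apply/eqP/negP => /negP ci0; apply: no_p; exists (\poly_(j < d) c (inord j)).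
  apply/eqP => /polyP/(_ i); rewrite coef_poly ltn_ord inord_val coef0 => c0.
  by rewrite c0 eqxx in ci0.
rewrite poly_def raddf_sum -[RHS]cX; apply: eq_bigr => j _.
have -> : X`_j = x ^+ j by rewrite -tnth_nth tnth_mktuple.
by rewrite /= linearZ /= rmorphXn /= horner_algX inord_val mulr_algl.
Qed.

(* In the homotope, the [m]-th power of [y] is [y (Delta y)^(m-1)], so that   *)
(* for [y = g(Delta)] it is [g(Delta)^m Delta^(m-1)].                         *)
Lemma aug_nilpotent : AA <> {:A}%VS ->
  exists n (y : B), y ^+ n = 0 /\ aug_trace y <> 0.
Proof.
move=> AAN; have [p p0 pD] := falg_annihilator Delta.
have [n [g [g0 pE]]] := root_pfactor p0.
pose gD := horner_alg Delta g.
have gDC : GRing.comm Delta gD.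
  by rewrite /GRing.comm -{1 2}[Delta](horner_algX Delta) -!rmorphM /= mulrC.
have powE m : aug_in gD ^+ m.+1 = aug_in (gD ^+ m.+1 * Delta ^+ m).
  elim: m => [|m IHm]; first by rewrite expr0 mulr1.
  rewrite exprS IHm aug_inM; congr (aug_in _).
  by rewrite -mulrA (mulrA Delta) (commrX _ gDC)
    [gD ^+ m.+2]exprS [Delta ^+ m.+1]exprS !mulrA.
have DnX : Delta ^+ n * gD = 0.
  rewrite -pD pE [g * _]mulrC rmorphM rmorphXn /=.
  by rewrite horner_algX.
(* The homotope power n + 1 contains Delta^n, and g(Delta) Delta^n = p(Delta) = 0. *)
exists n.+1, (aug_in gD); split.
  have gDnC : gD * Delta ^+ n = Delta ^+ n * gD
    by exact/commrX/commr_sym.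
  by rewrite powE exprSr -mulrA gDnC DnX mulr0.
move/eqP; rewrite aug_trace_eq0 /= => gD_AA; apply: AAN; apply/eqP.
rewrite eqEsubv subvf /=; apply/subvP=> x _.
have g0_root : root (g - g.[0]%:P) 0.
  by rewrite rootE hornerD hornerN hornerC subrr.
have /factor_theorem[q gq] := g0_root.
have gDE : gD = horner_alg Delta q * Delta + g.[0]%:A.
  rewrite /gD -[in LHS](subrK g.[0]%:P g) gq subr0 raddfD /= rmorphM /=.
  by rewrite horner_algX horner_algC.
(* If g(Delta) lies in the ideal A Delta A, then so does g(0) x = g(Delta) x - q(Delta) Delta x, for
   every x. *)
have : g.[0] *: x \in AA.
  have -> : g.[0] *: x = gD * x - horner_alg Delta q * Delta * x.
    by rewrite gDE mulrDl addrC addKr mulr_algl.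
  rewrite memvB ?mem_prodv_homotope //.
  have /subvP : (AA * {:A} <= AA)%VS by rewrite -prodvA prodvSr ?subvf.
  by apply; rewrite memv_mul ?memvf.
by rewrite rpredZeq (negPf g0).
Qed.

End HomotopeLemmas.

Unset Implicit Arguments.

Theorem corollary17 (k : closedFieldType) (hchar : [pchar k] =i pred0)
    (A : falgType k) (Delta : A) :
  ~ well_tempered Delta -> infinite_gldim (aug_homotope Delta).
Proof.
move=> not_wt.
have [m [y [ym0 tr_y]]] : exists m (y : aug_homotope Delta),
    y ^+ m = 0 /\ aug_trace y <> 0.
  by apply: aug_nilpotent => /prodv_homotope_well_tempered.
split=> n gld; apply: tr_y.
  apply: (@gldim_trace_nilpotent (aug_homotope Delta) A
    (@aug_trace k A Delta) n m) gld (@aug_traceC k A Delta) ym0.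
  exact: aug_fin_kernels.
(* The same y and trace serve the opposite ring: both the trace identity and nilpotency are
   symmetric. *)
apply: (@gldim_trace_nilpotent (aug_homotope Delta)^c A
  (@aug_trace k A Delta) n m) gld _ _; first exact: aug_fin_kernels_op.
  by move=> a b; exact: aug_traceC.
by rewrite revrX.
Qed.
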